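(* Let $\lambda>-1$, $t\in\mathbb{R}$, and let $\{S_n(x;t)\}_{n=0}^{\infty}$ be the monic orthogonal polynomials with respect to the generalized Freud weight $w(x;t)=|x|^{2\lambda+1}\exp(-x^4+tx^2)$ on $\mathbb{R}$, with recurrence coefficients $\beta_n=\beta_n(t;\lambda)$ in $$xS_n(x;t)=S_{n+1}(x;t)+\beta_nS_{n-1}(x;t),\qquad S_{-1}(x;t)=0,\ S_0(x;t)=1 .$$ Then $S_n(x;t)$ satisfies the differential-difference equation $$x\frac{dS_n}{dx}(x;t)=-B_n(x;t)S_n(x;t)+A_n(x;t)S_{n-1}(x;t),$$ where $$A_n(x;t)=4x\beta_n\left(x^2-\tfrac12t+\beta_n+\beta_{n+1}\right),\qquad B_n(x;t)=4x^2\beta_n+(\lambda+\tfrac12)[1-(-1)^n].$$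
   Context: Orthogonality means $\int_{-\infty}^\infty S_n(x;t)S_m(x;t)w(x;t)\,dx=h_n\delta_{mn}$ with $h_n>0$. Convention: $\beta_0=0$; $n$ ranges over the nonnegative integers. *)

(* Defs.v *)
From mathcomp Require Import all_boot all_order all_algebra.
From mathcomp Require Import all_classical all_reals all_analysis.

Set Implicit Arguments.
Unset Strict Implicit.
Unset Printing Implicit Defensive.

Import Order.TTheory GRing.Theory Num.Theory.
Import numFieldNormedType.Exports.

Local Open Scope ring_scope.

(* The value at x = 0 is a convention of powR (relevant only when
   2 * lambda + 1 <= 0) and does not affect integrals. *)
Definition freud_weight (R : realType) (lambda t x : R) : R :=
  `|x| `^ (2 * lambda + 1) * expR (- x ^+ 4 + t * x ^+ 2).

(* The integral is the extended-real-valued Lebesgue integral over the whole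
   line, so for a measurable weight the finite value required here also forces
   absolute integrability. *)
Definition monic_orthogonal_polynomials (R : realType) (w : R -> R)
    (S : nat -> {poly R}) : Prop :=
  (forall n, S n \is monic /\ size (S n) = n.+1) /\
  exists h : nat -> R, (forall n, 0 < h n) /\
    forall m n : nat,
      (\int[@lebesgue_measure R]_x ((S n).[x] * (S m).[x] * w x)%:E)%E =
      (if m == n then h n else 0)%:E.

Definition prev_poly (R : realType) (S : nat -> {poly R}) (n : nat) : {poly R} :=
  if n is m.+1 then S m else 0.

(* beta 0 multiplies S_{-1} = 0, so the recurrence leaves it free; it is fixed
   to 0 by convention. *)
Definition recurrence_coefficients (R : realType) (S : nat -> {poly R})
    (beta : nat -> R) : Prop :=
  [/\ S 0%N = 1, beta 0%N = 0 &
    forall (n : nat) (x : R),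
      x * (S n).[x] = (S n.+1).[x] + beta n * (prev_poly S n).[x]].

Definition freud_A (R : realType) (t : R) (beta : nat -> R) (n : nat) (x : R)
    : R :=
  4 * x * beta n * (x ^+ 2 - 2^-1 * t + beta n + beta n.+1).

Definition freud_B (R : realType) (lambda : R) (beta : nat -> R) (n : nat)
    (x : R) : R :=
  4 * x ^+ 2 * beta n + (lambda + 2^-1) * (1 - (-1) ^+ n).

(* Main.v *)
Require Import Defs.
From HB Require Import structures.
From mathcomp Require Import all_boot all_order all_algebra.
From mathcomp Require Import all_classical all_reals all_analysis.
From mathcomp Require Import measurable_realfun.
From mathcomp Require Import ring lra.

Import Order.TTheory GRing.Theory Num.Theory.
Import numFieldNormedType.Exports.

Local Open Scope ring_scope.

(** Write w for the weight, L(p) for the integral of p w, and M for the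
    polynomial 4 x^4 - 2 t x^2.  Off the origin x w' = (2 lambda + 1 - M) w, so
    (x p w)' = (x p' + (2 lambda + 2) p - M p) w for every polynomial p.  The
    function x p w tends to 0 at the origin, because it is of order
    |x|^(2 lambda + 2) there and lambda > -1, and at both infinities.
    Integrating over the line gives the Pearson identity
      L(x p' + (2 lambda + 2) p) = L(M p)          ([pearson_functional]).

    The rest is algebra with L.  The recurrence splits M S_n into a polynomial
    [lower_part] of degree at most n and a combination [upper_part] of S_n,
    S_(n+2) and S_(n+4).  The Pearson identity at p = S_n S_k with k < n says
    that x S_n' and M S_n have the same product with S_k, hence so do x S_n' and
    [lower_part n].  Both have degree at most n, so they differ by a multiple
    of S_n, which is read off the leading coefficients: n for x S_n', and
    g_n = 4 beta_n (beta_(n+1) + beta_n + beta_(n-1)) - 2 t beta_n for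
    [lower_part n].  The Pearson identity at p = S_n^2 gives
    g_n + g_(n+1) = 2 n + 2 lambda + 2; as g_0 = 0, this recursion yields
    g_n = n + (lambda + 1/2) (1 - (-1)^n)          ([string_eq]),
    and the resulting formula for x S_n' ([structure_relation]) is the claim. *)

(** * Polynomials *)

(** Brings the pointwise recurrence into the polynomial ring: a nonzero
    polynomial cannot vanish at all the natural numbers below its size. *)
Lemma poly_eq_horner (R : numDomainType) (p q : {poly R}) :
  (forall x, p.[x] = q.[x]) -> p = q.
Proof.
move=> pq; apply/eqP; rewrite -subr_eq0; apply: contraT => nz.
pose rs : seq R := [seq i%:R | i <- iota 0 (size (p - q))].
have all_rs : all (root (p - q)) rs.
  by apply/allP => x _; rewrite rootE hornerD hornerN pq subrr.
have uniq_rs : uniq rs.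
  by rewrite map_inj_uniq ?iota_uniq // => i j /eqP; rewrite eqr_nat => /eqP.
by have := max_poly_roots nz all_rs uniq_rs; rewrite size_map size_iota ltnn.
Qed.

Lemma coef_mulX_deriv (R : nzRingType) (p : {poly R}) n :
  ('X * p^`())`_n = n%:R * p`_n.
Proof.
by rewrite coefXM; case: n => [|n] /=; rewrite ?mul0r // coef_deriv mulr_natl.
Qed.

Lemma size_mulX_deriv (R : nzRingType) (p : {poly R}) :
  (size ('X * p^`())%R <= size p)%N.
Proof.
by apply/leq_sizeP => j le_pj; rewrite coef_mulX_deriv nth_default ?mulr0.
Qed.

(** * Multiplication by the quartic in the orthogonal basis *)

Section Algebra.
Variables (R : realType) (S : nat -> {poly R}) (beta : nat -> R).
Hypothesis S_monic : forall n, S n \is monic.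
Hypothesis size_S : forall n, size (S n) = n.+1.
Hypothesis S_rec : forall n, 'X * S n = S n.+1 + beta n *: prev_poly S n.
Hypothesis beta0 : beta 0%N = 0.

(** The factor [beta n] makes the recurrence one step down hold for n = 0 too,
    where both sides vanish; this spares case distinctions on small n. *)
Lemma beta_mulX_prev n :
  beta n *: ('X * prev_poly S n) =
  beta n *: (S n + beta n.-1 *: prev_poly S n.-1).
Proof. by case: n => [|n]; rewrite ?beta0 ?scale0r //= S_rec. Qed.

Lemma size_prev n : (size (prev_poly S n) <= n)%N.
Proof. by case: n => [|n] /=; rewrite ?size_poly0 ?size_S. Qed.

Lemma lead_S n : (S n)`_n = 1.
Proof. by have /monicP := S_monic n; rewrite lead_coefE size_S. Qed.

Lemma size_sub_lead n (q : {poly R}) :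
  (size q <= n.+1)%N -> (size (q - q`_n *: S n)%R <= n)%N.
Proof.
move=> sq; apply/leq_sizeP => j.
rewrite leq_eqVlt coefB coefZ => /predU1P[<-|lt_nj].
  by rewrite lead_S mulr1 subrr.
have q_j : q`_j = 0 by rewrite nth_default // (leq_trans sq).
have S_j : (S n)`_j = 0 by rewrite nth_default ?size_S.
by rewrite q_j S_j mulr0 subrr.
Qed.

Variable t : R.

(** This is A_n S_(n-1) - B_n S_n without the term of B_n that involves
    lambda. *)
Definition lower_part n : {poly R} :=
  4%:P * (beta n *: ('X *
    ('X^2 - (t / 2)%:P + (beta n)%:P + (beta n.+1)%:P) * prev_poly S n))
  - 4%:P * (beta n *: ('X^2 * S n)).

(** What [lower_part n] leaves of 4 x^4 - 2 t x^2 times S_n once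
    beta_n S_(n-1) = x S_n - S_(n+1) and beta_(n+1) S_n = x S_(n+1) - S_(n+2)
    are used to climb: only S_(n+1) and S_(n+2) remain. *)
Definition upper_part n : {poly R} :=
  4%:P * ('X * (- (t / 2)%:P + (beta n)%:P + (beta n.+1)%:P) * S n.+1)
  + 4%:P * ('X^2 * S n.+2).

(** The left-hand side of the discrete Painleve I (string) equation.  At n = 0
    the convention n.-1 = 0 is harmless because beta_0 = 0. *)
Definition string_value n : R :=
  4 * beta n * (beta n.+1 + beta n + beta n.-1) - 2 * t * beta n.

Lemma mul_quartic_split n :
  (4%:P * 'X^4 - (2 * t)%:P * 'X^2) * S n = lower_part n + upper_part n.
Proof.
rewrite /lower_part /upper_part.
have h1 := S_rec n; have h2 := S_rec n.+1; rewrite /= in h2.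
have e1 : beta n *: prev_poly S n = 'X * S n - S n.+1 by rewrite h1 addrC addKr.
have e2 : S n.+2 = 'X * S n.+1 - beta n.+1 *: S n by rewrite h2 addrK.
rewrite -!mul_polyC in e1 e2 *; rewrite e2.
have -> : (2 * t)%:P = 4%:P * (t / 2)%:P.
  by rewrite -polyCM; congr (_%:P); field.
(* The added multiple of beta_n S_(n-1) - (x S_n - S_(n+1)) vanishes, and
   turns the goal into a ring identity. *)
transitivity ((4%:P * 'X^4 - 4%:P * (t / 2)%:P * 'X^2) * S n
  + 4%:P * ('X * ('X^2 - (t / 2)%:P + (beta n)%:P + (beta n.+1)%:P)
    * ((beta n)%:P * prev_poly S n - ('X * S n - S n.+1)))).
  by rewrite e1 subrr !mulr0 addr0.
by ring.
Qed.

(** The terms of degree n + 2 of [lower_part n] cancel: replacing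
    x S_(n-1) - S_n by beta_(n-1) S_(n-2) leaves degree at most n. *)
Lemma lower_partE n : lower_part n =
  (4 * (beta n * beta n.-1)) *: ('X^2 * prev_poly S n.-1)
  + (4 * (beta n * (beta n + beta n.+1 - t / 2))) *: ('X * prev_poly S n).
Proof.
have e := beta_mulX_prev n; rewrite /lower_part -!mul_polyC in e *.
transitivity (4%:P * 'X^2 * ((beta n)%:P * ('X * prev_poly S n)
  - (beta n)%:P * (S n + (beta n.-1)%:P * prev_poly S n.-1))
  + ((4 * (beta n * beta n.-1))%:P * ('X^2 * prev_poly S n.-1)
  + (4 * (beta n * (beta n + beta n.+1 - t / 2)))%:P * ('X * prev_poly S n))).
  by rewrite !(polyCM, polyCD, polyCN); ring.
by rewrite e subrr mulr0 add0r.
Qed.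

Lemma size_lower_part n : (size (lower_part n) <= n.+1)%N.
Proof.
case: n => [|n].
  by rewrite lower_partE beta0 !mul0r !mulr0 !scale0r addr0 size_poly0.
rewrite lower_partE (leq_trans (size_polyD _ _)) // geq_max.
rewrite !(leq_trans (size_scale_leq _ _)) //.
  rewrite (leq_trans (size_polyMleq _ _)) // size_polyX add2n /=.
  by rewrite ltnS size_S.
rewrite (leq_trans (size_polyMleq _ _)) // size_polyXn addSn /= add2n.
by rewrite !ltnS size_prev.
Qed.

Lemma coef_lower_part n : (lower_part n)`_n = string_value n.
Proof.
rewrite lower_partE coefD !coefZ coefXM coefXnM /string_value.
case: n => [|[|n]] /=.
- by rewrite beta0 !mul0r !mulr0 !mul0r subrr addr0.
- by rewrite beta0 lead_S; field.
by rewrite subn2 /= !lead_S; field.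
Qed.

(** * The structure relation from orthogonality and the Pearson identity *)

Variables (L : {scalar {poly R}}) (h : nat -> R).
Hypothesis h_gt0 : forall n, 0 < h n.
Hypothesis L_orth : forall m n, L (S n * S m) = if m == n then h n else 0.

Let LD p q : L (p + q) = L p + L q. Proof. exact: linearD. Qed.
Let LB p q : L (p - q) = L p - L q. Proof. exact: linearB. Qed.
Let LZ c p : L (c *: p) = c * L p. Proof. exact: linearZ. Qed.

Lemma orth_small n (q : {poly R}) : (size q <= n)%N -> L (q * S n) = 0.
Proof.
(* The bound on the size of q is decoupled from n: the induction lowers it
   while S_n stays fixed. *)
move=> sq.
have [m le_mn] : exists2 m, (m <= n)%N & (size q <= m)%N by exists n.
elim: m => [|m IHm] in q {sq} le_mn * => sq.
  by move: sq; rewrite leqn0 size_poly_eq0 => /eqP ->; rewrite mul0r linear0.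
have -> : q = (q - q`_m *: S m) + q`_m *: S m by rewrite subrK.
rewrite mulrDl LD -scalerAl LZ L_orth gtn_eqF // mulr0 addr0.
by apply: IHm; [exact: ltnW|exact: size_sub_lead].
Qed.

Lemma orth_proj n (q : {poly R}) :
  (size q <= n.+1)%N -> L (q * S n) = q`_n * h n.
Proof.
move=> sq; rewrite -{1}(subrK (q`_n *: S n) q) mulrDl LD -scalerAl LZ.
rewrite L_orth eqxx orth_small ?add0r //.
exact: size_sub_lead.
Qed.

(** Testing against S_k with k + 1 the size of a nonzero q returns its leading
    coefficient times h_k, which is not 0. *)
Lemma orth_eq0 n (q : {poly R}) : (size q <= n.+1)%N ->
  (forall k, (k <= n)%N -> L (q * S k) = 0) -> q = 0.
Proof.
move=> sq q_orth; apply/eqP; apply: contraT => q_neq0.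
have size_q : (size q).-1.+1 = size q by rewrite prednK // size_poly_gt0.
have := q_orth (size q).-1; rewrite -ltnS size_q sq => /(_ isT).
rewrite orth_proj ?size_q // -lead_coefE => /eqP.
by rewrite mulf_eq0 lead_coef_eq0 (negPf q_neq0) gt_eqF.
Qed.

Lemma L_mul n m : L (S n * S m) = (n == m)%:R * h m.
Proof.
by rewrite L_orth eq_sym; case: eqP => [->|_]; rewrite ?mul1r ?mul0r.
Qed.

(** Pushed through the recurrence, [upper_part n] has S_n as its only component
    of index at most n, and the coefficient there is the next value of the
    sequence whose n-th value is the leading coefficient of [lower_part n]. *)
Lemma upper_partE n : upper_part n = 4 *: S n.+4
  + (4 * (beta n.+3 + beta n.+2 + beta n.+1 + beta n - t / 2)) *: S n.+2
  + string_value n.+1 *: S n.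
Proof.
have e1 := S_rec n.+1; have e2 := S_rec n.+2; have e3 := S_rec n.+3.
rewrite /= in e1 e2 e3; rewrite /upper_part -!mul_polyC in e1 e2 e3 *.
transitivity (
  4%:P * (- (t / 2)%:P + (beta n)%:P + (beta n.+1)%:P) * ('X * S n.+1)
  + 4%:P * 'X * ('X * S n.+2)); first by ring.
rewrite e1 e2.
transitivity (4%:P * (- (t / 2)%:P + (beta n)%:P + (beta n.+1)%:P) *
   (S n.+2 + (beta n.+1)%:P * S n) +
  4%:P * ('X * S n.+3 + (beta n.+2)%:P * ('X * S n.+1))); first by ring.
have g_half : string_value n.+1 =
    4 * beta n.+1 * (beta n.+2 + beta n.+1 + beta n - t / 2).
  by rewrite /string_value /=; field.
rewrite e1 e3 g_half !(polyCM, polyCD, polyCN).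
by ring.
Qed.

Lemma L_upper_part n k : (k <= n)%N ->
  L (upper_part n * S k) = (n == k)%:R * string_value n.+1 * h k.
Proof.
move=> le_kn; rewrite upper_partE !mulrDl -!scalerAl !LD !LZ !L_mul.
have /negPf-> : n.+4 != k by rewrite gtn_eqF // ltnS !leqW.
have /negPf-> : n.+2 != k by rewrite gtn_eqF // ltnS !leqW.
by rewrite !mul0r !mulr0 !add0r mulrCA.
Qed.

Variable lambda : R.
Hypothesis L_pearson : forall p : {poly R},
  L ('X * p^`() + (2 * lambda + 2) *: p) =
  L ((4%:P * 'X^4 - (2 * t)%:P * 'X^2) * p).

(** The Pearson identity at S_n S_k.  Since k <= n, both S_n (x S_k') and
    S_n S_k contribute only when k = n. *)
Lemma L_quartic n k : (k <= n)%N ->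
  L ((4%:P * 'X^4 - (2 * t)%:P * 'X^2) * (S n * S k)) =
  L ('X * (S n)^`() * S k) + (n == k)%:R * (n%:R + 2 * lambda + 2) * h k.
Proof.
move=> le_kn; rewrite -L_pearson derivM mulrDr LD LZ LD /=.
rewrite mulrA -addrA; congr (_ + _).
have -> : 'X * (S n * (S k)^`()) = 'X * (S k)^`() * S n.
  by rewrite mulrCA mulrC.
rewrite orth_proj; last by rewrite (leq_trans (size_mulX_deriv _ _)) // size_S.
rewrite coef_mulX_deriv L_mul.
have [<-|neq_nk] := eqVneq n k; first by rewrite lead_S /=; ring.
by rewrite nth_default ?size_S /=; [ring|rewrite ltn_neqAle eq_sym neq_nk].
Qed.

(** Two evaluations of L(M S_n^2): the split of M S_n gives the two string
    values, the Pearson identity gives 2 n + 2 lambda + 2. *)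
Lemma string_sum n :
  string_value n + string_value n.+1 = 2 * n%:R + 2 * lambda + 2.
Proof.
have size_dS : (size ('X * (S n)^`())%R <= n.+1)%N.
  by rewrite (leq_trans (size_mulX_deriv _ _)) ?size_S.
have := L_quartic n n (leqnn n).
rewrite mulrA mul_quartic_split [X in L X]mulrDl LD L_upper_part // eqxx.
rewrite (orth_proj _ _ (size_lower_part n)) (orth_proj _ _ size_dS).
rewrite coef_lower_part coef_mulX_deriv lead_S => e.
by apply: (mulIf (lt0r_neq0 (h_gt0 n))); move: e; rewrite /=; lra.
Qed.

(** The recursion [string_sum] starts from 0 because beta_0 = 0. *)
Lemma string_eq n : string_value n = n%:R + (lambda + 2^-1) * (1 - (-1) ^+ n).
Proof.
elim: n => [|n IHn]; first by rewrite /string_value beta0 expr0; ring.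
have -> : string_value n.+1 = 2 * n%:R + 2 * lambda + 2 - string_value n.
  by rewrite -string_sum addrC addKr.
by rewrite IHn exprS -natr1; field.
Qed.

(** Both sides have degree at most n and the same products with S_k for
    k <= n.  For k < n these are L(M S_n S_k), since [upper_part n] and S_n are
    orthogonal to S_k; the multiple of S_n is what makes k = n agree. *)
Lemma structure_relation n :
  'X * (S n)^`() = lower_part n - ((lambda + 2^-1) * (1 - (-1) ^+ n)) *: S n.
Proof.
set eps := (lambda + _) * _; apply/eqP; rewrite -subr_eq0; apply/eqP.
apply: (orth_eq0 n).
  rewrite (leq_trans (size_polyD _ _)) // geq_max size_polyN.
  rewrite (leq_trans (size_mulX_deriv _ _)) ?size_S //.
  rewrite (leq_trans (size_polyD _ _)) // geq_max size_polyN size_lower_part.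
  by rewrite (leq_trans (size_scale_leq _ _)) // size_S.
move=> k le_kn; rewrite mulrBl (mulrBl _ (lower_part n)) !LB -scalerAl LZ L_mul.
have := L_quartic n k le_kn.
rewrite mulrA mul_quartic_split mulrDl LD /= L_upper_part //.
have [<-|neq_nk] := eqVneq n k; last by rewrite /= => e; lra.
have := string_sum n; rewrite (string_eq n) -/eps => e.
have -> : string_value n.+1 = n%:R + 2 * lambda + 2 - eps by lra.
by rewrite /= !mul1r => e'; lra.
Qed.
End Algebra.

(** * Integrating a derivative with an exceptional point at the origin *)

Section Analysis.
Local Open Scope classical_set_scope.
Local Open Scope ring_scope.
Variable R : realType.
Notation mu := (@lebesgue_measure R).

(* The line minus the origin is exhausted by the sets lo n <= |x| <= hi n; the
   shift by 2 in both bounds gives lo n < hi n from n = 0 on. *)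
Let lo (n : nat) : R := n.+2%:R^-1.
Let hi (n : nat) : R := n.+2%:R.

Let lo_gt0 n : 0 < lo n. Proof. by rewrite invr_gt0. Qed.
Let lo_lt_hi n : lo n < hi n.
Proof.
by rewrite (@lt_trans _ _ 1) ?ltr1n // invf_lt1 ?ltr1n ?ltr0n.
Qed.

Let annulus n : set R := `[- hi n, - lo n]%classic `|` `[lo n, hi n]%classic.

Lemma near_annulus x : x != 0 -> \forall n \near \oo, annulus n x.
Proof.
move=> x_neq0; have nx_gt0 : 0 < `|x| by rewrite normr_gt0.
near=> n.
have hi_x : `|x| <= hi n.
  rewrite (@le_trans _ _ n%:R) ?ler_nat ?leqW //.
  by near: n; exact: nbhs_infty_ger.
have lo_x : lo n <= `|x|.
  rewrite -(invrK `|x|) lef_pV2 ?posrE ?invr_gt0 ?ltr0n //.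
  rewrite (@le_trans _ _ n%:R) ?ler_nat ?leqW //.
  by near: n; exact: nbhs_infty_ger.
rewrite /annulus /= !in_itv /=.
move: hi_x lo_x; have [x_ge0|x_lt0] := leP 0 x.
  by rewrite ger0_norm // => -> ->; right.
by rewrite ltr0_norm // lerNl lerNr => -> ->; left.
Unshelve. all: by end_near.
Qed.

Lemma measurable_annulus n : measurable (annulus n).
Proof. by apply: measurableU; exact: measurable_itv. Qed.

Lemma cvg_integral_annulus (f : R -> R) : mu.-integrable setT (EFin \o f) ->
  (\int[mu]_(x in annulus n) (f x)%:E)%E @[n --> \oo] -->
  (\int[mu]_x (f x)%:E)%E.
Proof.
move=> int_f; have /measurable_int mf := int_f.
have := @dominated_convergence _ _ _ mu setT measurableT
  (fun n x => (f x * \1_(annulus n) x)%:E) (EFin \o f) (abse \o (EFin \o f)).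
case => //.
- move=> n; apply/measurable_EFinP; apply: measurable_funM.
    exact/measurable_EFinP.
  by apply: measurable_indic; exact: measurable_annulus.
- exists [set 0]; split => //; first exact: lebesgue_measure_set1.
  move=> x /= nx; apply: contrapT => /eqP x_neq0; apply: nx => _.
  apply: cvg_near_cst; near=> n.
  rewrite indicE mem_set ?mulr1 //; near: n; exact: near_annulus.
- exact: integrable_abse.
- apply/aeW => x n _; rewrite lee_fin indicE.
  by case: (_ \in _); rewrite ?mulr1 ?mulr0 ?normr0.
move=> _ _; apply: cvg_trans; apply: near_eq_cvg.
near=> n; rewrite [RHS]integral_mkcond; apply: eq_integral => x _.
by rewrite patchE indicE; case: ifP => _; rewrite ?mulr1 ?mulr0.
Unshelve. all: by end_near.
Qed.

Lemma integral_derivative_itv (F f : R -> R) (a b : R) : a < b ->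
  {in `[a, b], forall x, is_derive x (1 : R) F (f x)} ->
  {in `[a, b], forall x, {for x, continuous f}} ->
  (\int[mu]_(x in `[a, b]) (f x)%:E = (F b - F a)%:E)%E.
Proof.
move=> lt_ab dF cf.
have cF x : x \in `[a, b] -> {for x, continuous F}.
  move=> /dF dFx; apply: differentiable_continuous.
  by apply/derivable1_diffP; apply: ex_derive.
rewrite (@continuous_FTC2 _ f F) //.
- by apply: continuous_in_subspaceT => x; rewrite inE; exact: cf.
- split.
  + move=> x /subset_itv_oo_cc /dF dFx; exact: ex_derive.
  + by apply: cvg_at_right_filter; apply: cF; rewrite in_itv /= lexx ltW.
  + by apply: cvg_at_left_filter; apply: cF; rewrite in_itv /= lexx ltW.
- move=> x /subset_itv_oo_cc /dF dFx; rewrite derive1E; exact: derive_val.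
Qed.

(** The fundamental theorem of calculus on each annulus leaves the values of F
    at its four endpoints, all of which tend to 0. *)
Lemma integral_derivative_eq0 (F f : R -> R) :
  mu.-integrable setT (EFin \o f) ->
  (forall x : R, x != 0 -> is_derive x (1 : R) F (f x)) ->
  (forall x : R, x != 0 -> {for x, continuous f}) ->
  F x @[x --> 0^'] --> 0 ->
  F x @[x --> +oo] --> 0 ->
  F x @[x --> -oo] --> 0 ->
  (\int[mu]_x (f x)%:E = 0)%E.
Proof.
move=> int_f dF cf F0 Fy FNy.
have cvg_f := cvg_integral_annulus f int_f.
have lo_cvg : lo n @[n --> \oo] --> 0.
  by rewrite (@cvg_shiftS R (@harmonic R)); exact: cvg_harmonic.
have hi_cvg : hi n @[n --> \oo] --> +oo.
  rewrite (@cvg_shiftS R (fun n => n.+1%:R)) (@cvg_shiftS R (fun n => n%:R)).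
  exact: cvgr_idn.
have F_lo : F (lo n) @[n --> \oo] --> 0.
  by apply: (proj1 (cvgr_dnbhsP F 0 0) F0); split=> // n; rewrite gt_eqF.
have F_Nlo : F (- lo n) @[n --> \oo] --> 0.
  apply: (proj1 (cvgr_dnbhsP F 0 0) F0 (fun n => - lo n)).
  by split=> [n|]; [rewrite oppr_eq0 gt_eqF|rewrite -oppr0; exact: cvgN].
have F_hi : F (hi n) @[n --> \oo] --> 0 by exact: cvg_comp hi_cvg Fy.
have F_Nhi : F (- hi n) @[n --> \oo] --> 0.
  by apply: cvg_comp FNy; apply/cvgNrNy.
have int_annulus n : (\int[mu]_(x in annulus n) (f x)%:E =
   ((F (- lo n) - F (- hi n)) + (F (hi n) - F (lo n)))%:E)%E.
  have neq0 x : x \in `[- hi n, - lo n] \/ x \in `[lo n, hi n] -> x != 0.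
    have := lo_gt0 n; rewrite !in_itv /=; move: (lo n) => l l0.
    by case=> /andP[? ?]; apply/eqP; lra.
  rewrite integral_setU //; last 2 first.
  - apply: measurable_funTS; exact: measurable_int int_f.
  - apply/disj_set2P; rewrite -subset0 => x [] /=; rewrite !in_itv /=.
    by have := lo_gt0 n; move: (lo n) => l; lra.
  have left : - hi n < - lo n by rewrite ltrN2.
  rewrite (integral_derivative_itv F f _ _ left) => [|x xI|x xI].
  - rewrite (integral_derivative_itv F f _ _ (lo_lt_hi n)) => [//|x xI|x xI].
    + by apply: dF; apply: neq0; right.
    + by apply: cf; apply: neq0; right.
  - by apply: dF; apply: neq0; left.
  - by apply: cf; apply: neq0; left.
have cvg_0 :
    (\int[mu]_(x in annulus n) (f x)%:E)%E @[n --> \oo] --> (0:R)%:E.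
  under eq_fun do rewrite int_annulus.
  apply: cvg_EFin; first by near=> n.
  rewrite [X in _ --> X](_ : _ = (0 - 0) + (0 - 0)); last first.
    by rewrite !subrr addr0.
  by apply: cvgD; exact: cvgB.
exact: cvg_unique cvg_f cvg_0.
Unshelve. all: by end_near.
Qed.

(** * Integrability of polynomials against an orthogonality weight *)

(** A finite value of the integral of S_n S_0 w already means that S_n w is
    absolutely integrable, and the S_n span all polynomials. *)
Lemma integrable_poly_weight (w : R -> R) (S : nat -> {poly R})
    (q : {poly R}) :
  measurable_fun setT w -> monic_orthogonal_polynomials w S ->
  mu.-integrable setT (fun x => (q.[x] * w x)%:E).
Proof.
move=> mw [monic_S [h [_ orth]]].
have S_monic n : S n \is monic by have [] := monic_S n.
have size_S n : size (S n) = n.+1 by have [] := monic_S n.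
have S0 : S 0%N = 1.
  have := S_monic 0%N; rewrite [S 0%N]size1_polyC ?size_S //.
  by rewrite monicE lead_coefC => /eqP ->.
have int_S n : mu.-integrable setT (fun x => ((S n).[x] * w x)%:E).
  have mSw : measurable_fun setT (fun x => (S n).[x] * w x).
    by apply: measurable_funM => //; exact: measurable_poly.
  apply/integrableP; split; first exact/measurable_EFinP.
  rewrite integral_fin_num_abs //.
  rewrite (_ : (\int[mu]_x _)%E = (if 0%N == n then h n else 0)%:E) //.
  rewrite -orth; apply: eq_integral => x _.
  by rewrite S0 -polyC1 hornerC mulr1.
suff main n (p : {poly R}) : (size p <= n)%N ->
    mu.-integrable setT (fun x => (p.[x] * w x)%:E).
  exact: main (leqnn _).
elim: n => [|n IHn] in p *.
  rewrite leqn0 size_poly_eq0 => /eqP ->.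
  under eq_fun do rewrite horner0 mul0r; exact: integrable0.
move=> size_p.
have -> : (fun x => (p.[x] * w x)%:E) =
  (fun x => ((p - p`_n *: S n).[x] * w x)%:E
            + (p`_n)%:E * ((S n).[x] * w x)%:E)%E.
  apply/funext => x; rewrite -EFinM -EFinD hornerD hornerN hornerZ.
  by congr EFin; ring.
apply: integrableD => //; last exact: integrableZl.
by apply: IHn; exact: size_sub_lead.
Qed.

(** * The Freud weight *)

Variables (lambda t : R).
Notation w := (freud_weight lambda t).

Let expo : {poly R} := t *: 'X^2 - 'X^4.

Let horner_expo x : expo.[x] = - x ^+ 4 + t * x ^+ 2.
Proof. by rewrite /expo hornerD hornerN hornerZ !hornerXn addrC. Qed.

(** Writing |x|^(2 lambda + 1) as a power of x^2 gives one smooth expression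
    for both signs of x. *)
Lemma freud_weight_expE (x : R) : x != 0 ->
  w x = expR ((lambda + 2^-1) * ln (x ^+ 2) - x ^+ 4 + t * x ^+ 2).
Proof.
move=> x_neq0; have nx_gt0 : 0 < `|x| by rewrite normr_gt0.
rewrite /freud_weight /powR normr_eq0 (negPf x_neq0) -expRD; congr expR.
have -> : ln (x ^+ 2) = 2 * ln `|x|.
  by rewrite -real_normK ?num_real // lnXn // mulr_natl.
by field.
Qed.

Lemma is_derive_freud_weight (x : R) : x != 0 ->
  is_derive x (1 : R) w (w x * ((2 * lambda + 1) / x - 4 * x ^+ 3 + 2 * t * x)).
Proof.
move=> x_neq0; have x2_gt0 : 0 < x ^+ 2 by rewrite exprn_even_gt0.
pose u := ((lambda + 2^-1) \*: (@ln R \o horner 'X^2)) + horner expo.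
have wE y : y != 0 -> w y = expR (u y).
  move=> /freud_weight_expE ->; congr expR.
  by rewrite /u !fctE /= horner_expo hornerXn /GRing.scale /=; ring.
have du :
    is_derive x (1 : R) u ((2 * lambda + 1) / x - 4 * x ^+ 3 + 2 * t * x).
  have dln : is_derive x (1 : R) (@ln R \o horner 'X^2)
      ((x ^+ 2)^-1 * ('X^2)^`().[x]).
    apply: is_derive1_comp (is_derive_poly _ _).
    by rewrite hornerXn; exact: is_derive1_ln.
  have := is_deriveD (is_deriveZ (lambda + 2^-1) dln) (is_derive_poly expo x).
  move/is_derive_eq; apply; rewrite /GRing.scale /= /expo.
  by rewrite derivD derivN derivZ !derivXn !hornerE /=; field.
rewrite wE //.
apply: (@near_eq_is_derive _ _ _ (expR \o u)).
near=> y; rewrite wE //.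
by near: y; exact: cvgr_neq0 cvg_id x_neq0.
Unshelve. all: by end_near.
Qed.

Lemma freud_weight_gt0 (x : R) : x != 0 -> 0 < w x.
Proof. by move=> ?; rewrite freud_weight_expE ?expR_gt0. Qed.

(** With y = x^2 >= |x| >= 1, ln y lies between 0 and y, so w is at most
    exp(K' y - y^2) with K' = |lambda + 1/2| + |t|, while |x|^(k+1) is at most
    (k+1)! exp(y).  The product stays bounded because K y - y^2 <= K^2, where
    K = K' + 1. *)
Lemma freud_weight_bound k : exists C : R, forall x : R, 1 <= `|x| ->
  `|x ^+ k * w x| <= C * `|x|^-1.
Proof.
pose K := `|lambda + 2^-1| + `|t| + 1.
exists ((k.+1)`!%:R * expR (K ^+ 2)) => x x_ge1.
have x_neq0 : x != 0 by rewrite -normr_gt0 (lt_le_trans ltr01).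
rewrite ler_pdivlMr ?normr_gt0 // normrM normrX.
rewrite (gtr0_norm (freud_weight_gt0 _ x_neq0)).
rewrite mulrAC -exprSr freud_weight_expE //.
set y := x ^+ 2; have -> : x ^+ 4 = y ^+ 2 by rewrite -exprM.
have y_ge1 : 1 <= y by rewrite /y -real_normK ?num_real // exprn_ege1.
have x_le_y : `|x| <= y by rewrite /y -real_normK ?num_real // ler_eXnr.
have y_ge0 : 0 <= y by exact: le_trans y_ge1.
have pow_le : `|x| ^+ k.+1 <= (k.+1)`!%:R * expR y.
  apply: (@le_trans _ _ (y ^+ k.+1)); first by rewrite lerXn2r ?nnegrE.
  rewrite mulrC -ler_pdivrMr ?ltr0n ?fact_gt0 //.
  by apply: le_trans (expR_ge1Dxn k y_ge0); rewrite lerDr.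
apply: (le_trans (ler_wpM2r (expR_ge0 _) pow_le)).
rewrite -mulrA -expRD ler_wpM2l // ler_expR.
have ln_ge0y : 0 <= ln y by exact: ln_ge0.
have ln_ley : ln y <= y.
  by rewrite -{1}(subrK 1 y) addrC; apply: le_trans (le_ln1Dx _) _; lra.
have c_ln : (lambda + 2^-1) * ln y <= `|lambda + 2^-1| * y.
  apply: (@le_trans _ _ (`|lambda + 2^-1| * ln y)).
    by rewrite ler_wpM2r ?ler_norm.
  by rewrite ler_wpM2l.
have t_y : t * y <= `|t| * y by rewrite ler_wpM2r ?ler_norm.
have K_y : K * y - y ^+ 2 <= K ^+ 2 by nra.
by apply: le_trans K_y; rewrite /K; lra.
Qed.

(** Stated along a map g with |g| tending to +oo, to cover both ends of the
    line at once. *)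
Lemma cvg_poly_freud_weight (T : Type) (G : set_system T) (FG : Filter G)
    (g : T -> R) (p : {poly R}) :
  `|g z| @[z --> G] --> +oo -> p.[g z] * w (g z) @[z --> G] --> 0.
Proof.
move=> g_oo.
suff mono k : g z ^+ k * w (g z) @[z --> G] --> 0.
  (* Generalized over k: Horner's scheme moves a factor x out of p. *)
  suff main k : g z ^+ k * (p.[g z] * w (g z)) @[z --> G] --> 0.
    by have := main 0; under eq_fun do rewrite expr0 mul1r.
  elim/poly_ind: p => [|p c IHp] in k *.
    under eq_fun do rewrite horner0 mul0r mulr0; exact: cvg_cst.
  have : g z ^+ k.+1 * (p.[g z] * w (g z)) + c * (g z ^+ k * w (g z))
      @[z --> G] --> 0 + c * 0.
    by apply: cvgD => //; apply: cvgMr; exact: mono.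
  rewrite mulr0 addr0; apply: cvg_trans; apply: near_eq_cvg; near=> z.
  by rewrite hornerMXaddC exprS; ring.
have [C bound] := freud_weight_bound k.
apply/norm_cvg0P.
apply: (@squeeze_cvgr _ _ _ _ (cst 0) (fun z => C * `|g z|^-1)).
- near=> z; rewrite normr_ge0 bound //.
  by near: z; move/cvgryPge : g_oo; exact.
- exact: cvg_cst.
- rewrite -(mulr0 C); apply: cvgMr; apply/gtr0_cvgV0 => //.
  by near=> z; near: z; move/cvgryPgt : g_oo; exact.
Unshelve. all: by end_near.
Qed.

(** The factor x raises the exponent 2 lambda + 1 of the weight, which may be
    negative, to 2 lambda + 2 > 0. *)
Lemma cvg_mulX_freud_weight (p : {poly R}) : -1 < lambda ->
  x * p.[x] * w x @[x --> 0^'] --> (0 : R).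
Proof.
move=> lambda_gt; have e_gt0 : 0 < 2 * lambda + 2 by lra.
pose r (x : R) := `|p.[x] * expR (- x ^+ 4 + t * x ^+ 2)|.
have normF x : `|x * p.[x] * w x| = r x * `|x| `^ (2 * lambda + 2).
  rewrite -mulr_powRB1 //.
  rewrite (_ : 2 * lambda + 2 - 1 = 2 * lambda + 1); last by ring.
  by rewrite /r /freud_weight !normrM (ger0_norm (powR_ge0 _ _)); ring.
apply/norm_cvg0P; under eq_fun do rewrite normF.
have cvg_r : r x @[x --> 0^'] --> r 0.
  apply: cvg_within_filter; rewrite /r; apply: cvg_norm.
  apply: cvgM; first exact: continuous_horner.
  rewrite -horner_expo; under eq_fun do rewrite -horner_expo.
  by apply: continuous_comp; [exact: continuous_horner|exact: continuous_expR].
suff : r x * `|x| `^ (2 * lambda + 2) @[x --> 0^'] --> r 0 * 0 by rewrite mulr0.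
apply: cvgM => //.
apply/(cvgr_dnbhsP (fun x => `|x| `^ (2 * lambda + 2))) => u [u_neq0 u_0].
apply: (proj1 (cvg_at_rightP (fun a : R => a `^ (2 * lambda + 2)) 0 0)
  (powR_cvg0 e_gt0) (fun n => `|u n|)).
by split=> [n|]; [rewrite normr_gt0|rewrite -(normr0 R); exact: cvg_norm].
Qed.

Lemma measurable_freud_weight : measurable_fun setT w.
Proof.
apply: measurable_funM.
  by apply: (measurableT_comp (measurable_powR _)); exact: normr_measurable.
apply: measurableT_comp => //.
apply: measurable_funD.
  by apply: measurableT_comp => //; exact: measurable_funX.
by apply: measurable_funM => //; exact: measurable_funX.
Qed.

(** The integrand is the derivative of x p w off the origin. *)
Lemma integral_pearson (p : {poly R}) : -1 < lambda ->
  (forall q : {poly R}, mu.-integrable setT (fun x => (q.[x] * w x)%:E)) ->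
  (\int[mu]_x (('X * p^`() + (2 * lambda + 2) *: p
    - (4%:P * 'X^4 - (2 * t)%:P * 'X^2) * p).[x] * w x)%:E = 0)%E.
Proof.
move=> lambda_gt int_w; set q := (_ - _).
have qE x : q.[x] = x * p^`().[x] + (2 * lambda + 2) * p.[x]
    - (4 * x ^+ 4 - 2 * t * x ^+ 2) * p.[x].
  rewrite /q hornerD hornerN hornerD hornerZ (hornerM 'X) hornerX.
  by rewrite (hornerM (_ - _)) hornerD hornerN !hornerCM !hornerXn.
have cw x : x != 0 -> {for x, continuous w}.
  move=> /is_derive_freud_weight dw; apply: differentiable_continuous.
  by apply/derivable1_diffP; apply: ex_derive.
have F_E : (fun x => x * p.[x] * w x) = (fun x => ('X * p).[x] * w x).
  by apply/funext => x; rewrite hornerM hornerX.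
apply: (integral_derivative_eq0 (fun x => x * p.[x] * w x)).
- exact: int_w.
- move=> x x_neq0; have dw := is_derive_freud_weight x x_neq0.
  have := is_deriveM (is_derive_poly ('X * p) x) dw.
  rewrite F_E => /is_derive_eq; apply.
  rewrite /GRing.scale /= qE derivM derivX.
  rewrite !(hornerD, hornerM, hornerX, hornerC).
  by field.
- by move=> x x_neq0; apply: cvgM; [exact: continuous_horner|exact: cw].
- exact: cvg_mulX_freud_weight.
- rewrite F_E; apply: (cvg_poly_freud_weight _ _ _ id).
  apply/cvgryPge => A; near=> x; apply: le_trans (ler_norm _).
  by near: x; exact: nbhs_pinfty_ge (num_real A).
- rewrite F_E; apply: (cvg_poly_freud_weight _ _ _ id).
  apply/cvgryPge => A; near=> x; rewrite -normrN; apply: le_trans (ler_norm _).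
  by rewrite lerNr; near: x; exact: nbhs_ninfty_le (num_real (- A)).
Unshelve. all: by end_near.
Qed.
End Analysis.

(** * The theorem *)

(** Integration is linear only on integrable functions; since every p w is one,
    it gives a linear form on all polynomials. *)
Lemma pearson_functional (R : realType) (lambda t : R) : -1 < lambda ->
  (forall p : {poly R}, (@lebesgue_measure R).-integrable setT
     (fun x => (p.[x] * freud_weight lambda t x)%:E)) ->
  exists L : {scalar {poly R}},
    (forall p, L p =
      \int[@lebesgue_measure R]_x (p.[x] * freud_weight lambda t x)) /\
    (forall p, L ('X * p^`() + (2 * lambda + 2) *: p) =
               L ((4%:P * 'X^4 - (2 * t)%:P * 'X^2) * p)).
Proof.
move=> lambda_gt int_w.
pose f (p : {poly R}) :=
  \int[@lebesgue_measure R]_x (p.[x] * freud_weight lambda t x).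
have lin_f : scalar f.
  move=> a p q; rewrite /f -(RintegralZl _ _ (int_w p)) //.
  rewrite -(RintegralD _ _ (int_w q)) //.
    by apply: eq_Rintegral => x _; rewrite hornerD hornerZ mulrDl -mulrA.
  by have := int_w (a *: p); under eq_fun do rewrite hornerZ -mulrA.
pose L : {scalar {poly R}} :=
  HB.pack f (GRing.isLinear.Build R {poly R} R *%R f lin_f).
exists L; split=> // p; apply/eqP; rewrite -subr_eq0 -linearB /=; apply/eqP.
by rewrite /f /Rintegral integral_pearson.
Qed.

Theorem theorem4p8 (R : realType) (lambda t : R)
    (S : nat -> {poly R}) (beta : nat -> R) :
  -1 < lambda ->
  monic_orthogonal_polynomials (freud_weight lambda t) S ->
  recurrence_coefficients S beta ->
  forall (n : nat) (x : R),
    x * derive1 (fun y : R => (S n).[y]) x =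
    - freud_B lambda beta n x * (S n).[x]
    + freud_A t beta n x * (prev_poly S n).[x].
Proof.
move=> lambda_gt orth_S [S0 beta0 rec_S] n x.
have int_w p := integrable_poly_weight _ _ _ p
  (measurable_freud_weight _ lambda t) orth_S.
have [L [LE L_pearson]] := pearson_functional _ _ _ lambda_gt int_w.
have [monic_S [h [h_gt0 orth]]] := orth_S.
have S_monic k : S k \is monic by have [] := monic_S k.
have size_S k : size (S k) = k.+1 by have [] := monic_S k.
have S_rec k : 'X * S k = S k.+1 + beta k *: prev_poly S k.
  by apply: poly_eq_horner => y; rewrite hornerM hornerX hornerD hornerZ rec_S.
have L_orth k m : L (S m * S k) = if k == m then h m else 0.
  rewrite LE /Rintegral.
  under eq_integral do rewrite hornerM.
  by rewrite orth.
have := structure_relation _ _ _ S_monic size_S S_rec beta0 _ _ _ h_gt0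
  L_orth _ L_pearson n.
move=> /(congr1 (horner^~ x)); rewrite -derivE hornerM hornerX => ->.
rewrite /lower_part /freud_A /freud_B.
rewrite hornerD hornerN hornerD hornerN hornerZ !hornerCM !hornerZ.
rewrite hornerM hornerM hornerX !hornerD hornerN (hornerM _ (S n)).
rewrite !hornerXn !hornerC.
by field.
Qed.
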